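(* Let $G$ be a groupoid, let $H$ be a small category, and let $(\varphi,\alpha)$ be a left action of $G$ on $H$. Define $H_r=\{h\in H:\varphi(\mathbf{s}(h))=\varphi(\mathbf{t}(h))\}$. Then $H_r$ is a subcategory of $H$, and $C^*(H\times_\alpha G)\cong C^*(H_r\times_\alpha G)$ ($*$-isomorphism), where $G$ acts on $H_r$ by the restriction of $\alpha$.
   Context: **Small categories.** A small category $\Lambda$ is identified with its set of morphisms; objects are identified with identity morphisms, and $\Lambda^{(0)}$ denotes the set of objects. $\mathbf{s},\mathbf{t}$ are the source and target maps; $(f,g)\in\Lambda^{(2)}$ (composable, with product $fg$) iff $\mathbf{s}(f)=\mathbf{t}(g)$. A groupoid is a small category in which all morphisms are invertible. For $f,g\in\Lambda$, $f$ and $g$ intersect if they have a common multiple, i.e. $fh=gk$ for some $h,k\in\Lambda$; otherwise they are disjoint, written $f\perp g$. **Action.** Let $G,H$ be small categories and $\varphi:H^{(0)}\to G^{(0)}$ a map (always assumed surjective). Put $G\times^\varphi H=\{(g,h)\in G\times H:\mathbf{s}(g)=\varphi(\mathbf{t}(h))=\varphi(\mathbf{s}(h))\}$. A left action $(\varphi,\alpha)$ of $G$ on $H$ is a map $(g,h)\mapsto\alpha_g(h)$ from $G\times^\varphi H$ to $H$ such that for any $(g',g)\in G^{(2)}$, $(h',h)\in H^{(2)}$, $u\in H^{(0)}$ with $(g,h),(g,u),(g,h')\in G\times^\varphi H$: $\alpha_g(\mathbf{s}(h))=\mathbf{s}(\alpha_g(h))$; $\alpha_g(\mathbf{t}(h))=\mathbf{t}(\alpha_g(h))$;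 $\varphi(\alpha_g(u))=\mathbf{t}(g)$; $\alpha_{\varphi(\mathbf{t}(h))}(h)=h$; $\alpha_{g'}(\alpha_g(h))=\alpha_{g'g}(h)$; $\alpha_g(h'h)=\alpha_g(h')\alpha_g(h)$. **Semi-direct product.** For a groupoid $G$ acting on $H$, $H\times_\alpha G=\{(h,g)\in H\times G:\mathbf{t}(g)=\varphi(\mathbf{s}(h))=\varphi(\mathbf{t}(h))\}$ is a small category with $\mathbf{s}(h,g)=\alpha_{g^{-1}}(\mathbf{s}(h))$, $\mathbf{t}(h,g)=\mathbf{t}(h)$ (where $u\in H^{(0)}$ is identified with $(u,\varphi(u))$) and, when $\mathbf{s}(\alpha_{g^{-1}}(h))=\mathbf{t}(h')$, $(h,g)(h',g')=(h\alpha_g(h'),gg')$. **$C^*$-algebra of a small category.** A representation of $\Lambda$ in a unital $C^*$-algebra $B$ is a map $S:\Lambda\to B$, $f\mapsto S_f$, such that: each $S_f$ is a partial isometry; $S_fS_g=S_{fg}$ if $(f,g)\in\Lambda^{(2)}$ and $S_fS_g=0$ otherwise; the projections $Q_f=S_f^*S_f$ and $P_g=S_gS_g^*$ ($f,g\in\Lambda$) all commute with each other; $P_fP_g=0$ if $f\perp g$; $Q_fP_g=P_g$ if $(f,g)\in\Lambda^{(2)}$. $C^*(\Lambda)$ is the universal $C^*$-algebra generated by partial isometries $\{S_f\}_{f\in\Lambda}$ subject to $f\mapsto S_f$ being a representation: for every representation $T$ of $\Lambda$ in a unital $C^*$-algebra $B$ there is a unique $*$-homomorphism $C^*(\Lambda)\to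 B$ sending $S_f$ to $T_f$ for all $f$. *)

(* Defs.v *)
From mathcomp Require Import all_boot all_order all_algebra.
From mathcomp Require Import all_classical all_reals topology normedtype.
From mathcomp Require Import complex.

Set Implicit Arguments.
Unset Strict Implicit.
Unset Printing Implicit Defensive.

Import Order.TTheory GRing.Theory Num.Theory.
Import numFieldNormedType.Exports.

Local Open Scope classical_set_scope.
Local Open Scope ring_scope.

(** * Small categories

    [comp f g] is the product fg, defined exactly when [src f = tgt g].
    Partial operations (here, and the action below) take a proof that the
    arguments lie in the domain; such proofs are irrelevant, by
    [Prop_irrelevance]. The identification of an object [u] with its identity
    morphism is the explicit map [idm]. *)

Record smallCat : Type := SmallCat {
  obj : Type;
  mor :> Type;
  src : mor -> obj;
  tgt : mor -> obj;
  idm : obj -> mor;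
  comp : forall f g : mor, src f = tgt g -> mor;
  src_idm : forall u, src (idm u) = u;
  tgt_idm : forall u, tgt (idm u) = u;
  src_comp : forall f g (e : src f = tgt g), src (comp e) = src g;
  tgt_comp : forall f g (e : src f = tgt g), tgt (comp e) = tgt f;
  comp_idl : forall f (e : src (idm (tgt f)) = tgt f), comp e = f;
  comp_idr : forall f (e : src f = tgt (idm (src f))), comp e = f;
  compA : forall f g h (fg : src f = tgt g) (gh : src g = tgt h)
    (e1 : src (comp fg) = tgt h) (e2 : src f = tgt (comp gh)),
    comp e1 = comp e2
}.

Arguments src {_}.
Arguments tgt {_}.
Arguments idm {_}.
Arguments comp {_} f g _.

Record groupoid : Type := Groupoid {
  gpd_cat :> smallCat;
  inv : gpd_cat -> gpd_cat;
  src_inv : forall g, src (inv g) = tgt g;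
  tgt_inv : forall g, tgt (inv g) = src g;
  comp_inv : forall g (e : src g = tgt (inv g)), comp g (inv g) e = idm (tgt g);
  inv_comp : forall g (e : src (inv g) = tgt g), comp (inv g) g e = idm (src g)
}.

Arguments inv {_}.

(** [f] and [g] intersect, i.e. have a common multiple. *)
Definition meets (L : smallCat) (f g : L) : Prop :=
  exists (h k : L) (eh : src f = tgt h) (ek : src g = tgt k),
    comp f h eh = comp g k ek.

Definition perp (L : smallCat) (f g : L) : Prop := ~ meets f g.

(** * Subcategories *)

Record is_subcategory (H : smallCat) (K : set H) : Prop := IsSubcategory {
  subcat_src : forall h, K h -> K (idm (src h));
  subcat_tgt : forall h, K h -> K (idm (tgt h));
  subcat_comp : forall h k (e : src h = tgt k), K h -> K k -> K (comp h k e)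
}.

Lemma sig_inj (T : Type) (P : T -> Prop) (x y : {z : T | P z}) :
  sval x = sval y -> x = y.
Proof.
case: x y => [x px] [y py] /= exy; move: px py; rewrite {}exy => px py.
by rewrite (Prop_irrelevance px py).
Qed.

Lemma comp_congr (L : smallCat) (f f' g g' : L) e e' :
  f = f' -> g = g' -> comp f g e = comp f' g' e'.
Proof.
move=> ff gg; move: e e'; rewrite ff gg => e e'.
by rewrite (Prop_irrelevance e e').
Qed.

Section Subcat.
Variables (H : smallCat) (K : set H) (subK : is_subcategory K).

Definition subobj : Type := {u : obj H | K (idm u)}.
Definition submor : Type := {h : H | K h}.

Definition subsrc (h : submor) : subobj :=
  exist _ (src (sval h)) (subcat_src subK (svalP h)).
Definition subtgt (h : submor) : subobj :=
  exist _ (tgt (sval h)) (subcat_tgt subK (svalP h)).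
Definition subidm (u : subobj) : submor := exist _ (idm (sval u)) (svalP u).
Definition subcomp (h k : submor) (e : subsrc h = subtgt k) : submor :=
  exist _ (comp (sval h) (sval k) (congr1 sval e))
    (subcat_comp subK (congr1 sval e) (svalP h) (svalP k)).

Lemma subsrc_idm u : subsrc (subidm u) = u.
Proof. by apply: sig_inj; rewrite /= src_idm. Qed.

Lemma subtgt_idm u : subtgt (subidm u) = u.
Proof. by apply: sig_inj; rewrite /= tgt_idm. Qed.

Lemma subsrc_comp h k (e : subsrc h = subtgt k) :
  subsrc (subcomp e) = subsrc k.
Proof. by apply: sig_inj; rewrite /= src_comp. Qed.

Lemma subtgt_comp h k (e : subsrc h = subtgt k) :
  subtgt (subcomp e) = subtgt h.
Proof. by apply: sig_inj; rewrite /= tgt_comp. Qed.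

Lemma subcomp_idl h (e : subsrc (subidm (subtgt h)) = subtgt h) :
  subcomp e = h.
Proof. by apply: sig_inj; rewrite /= comp_idl. Qed.

Lemma subcomp_idr h (e : subsrc h = subtgt (subidm (subsrc h))) :
  subcomp e = h.
Proof. by apply: sig_inj; rewrite /= comp_idr. Qed.

Lemma subcompA f g h (fg : subsrc f = subtgt g) (gh : subsrc g = subtgt h)
    (e1 : subsrc (subcomp fg) = subtgt h)
    (e2 : subsrc f = subtgt (subcomp gh)) :
  subcomp e1 = subcomp e2.
Proof. by apply: sig_inj; apply: compA. Qed.

Definition subcat : smallCat :=
  SmallCat subsrc_idm subtgt_idm subsrc_comp subtgt_comp
    subcomp_idl subcomp_idr subcompA.

End Subcat.

(** * Actions *)

(** [(g, h)] lies in the domain of an action with moment map [phi]. *)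
Definition fibred (G H : smallCat) (phi : obj H -> obj G) (g : G) (h : H) :=
  src g = phi (tgt h) /\ phi (tgt h) = phi (src h).

Record catAction (G H : smallCat) : Type := CatAction {
  phi : obj H -> obj G;
  phi_surj : forall a, exists u, phi u = a;
  act : forall (g : G) (h : H), fibred phi g h -> H;
  act_src : forall g h (p : fibred phi g h) (q : fibred phi g (idm (src h))),
    act q = idm (src (act p));
  act_tgt : forall g h (p : fibred phi g h) (q : fibred phi g (idm (tgt h))),
    act q = idm (tgt (act p));
  phi_act : forall g u v (p : fibred phi g (idm u)),
    act p = idm v -> phi v = tgt g;
  act_id : forall h (p : fibred phi (idm (phi (tgt h))) h), act p = h;
  act_act : forall g' g h (e : src g' = tgt g) (p : fibred phi g h)
    (q : fibred phi g' (act p)) (r : fibred phi (comp g' g e) h),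
    act q = act r;
  act_comp : forall g h' h (e : src h' = tgt h)
    (p' : fibred phi g h') (p : fibred phi g h)
    (r : fibred phi g (comp h' h e)) (e' : src (act p') = tgt (act p)),
    act r = comp (act p') (act p) e'
}.

Arguments phi {G H} _ _.
Arguments act {G H} _ g h _.

(** [beta] is the restriction of [alpha] to the subcategory [K]. *)
Definition is_restriction (G H : smallCat) (alpha : catAction G H)
    (K : set H) (subK : is_subcategory K) (beta : catAction G (subcat subK)) :=
  (forall u : subobj K, phi beta u = phi alpha (sval u)) /\
  (forall (g : G) (h : submor K) (p : fibred (phi alpha) g (sval h))
     (q : fibred (phi beta) g h), sval (act beta g h q) = act alpha g (sval h) p).

(** * Semi-direct products *)

Section Semidirect.
Variables (G : groupoid) (H : smallCat) (alpha : catAction G H).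
Local Notation ph := (phi alpha).

Definition sdmor : Type :=
  {hg : H * G | tgt hg.2 = ph (src hg.1) /\ ph (src hg.1) = ph (tgt hg.1)}.

Implicit Types x y z : sdmor.

Lemma act_congr (g g' : G) (h h' : H) p p' :
  g = g' -> h = h' -> act alpha g h p = act alpha g' h' p'.
Proof.
move=> gg hh; move: p p'; rewrite gg hh => p p'.
by rewrite (Prop_irrelevance p p').
Qed.

Lemma fibred_idm (g : G) u : src g = ph u -> fibred ph g (idm u).
Proof. by move=> e; split; rewrite tgt_idm ?src_idm. Qed.

Lemma src_act_idm (g : G) u p :
  act alpha g (idm u) p = idm (src (act alpha g (idm u) p)).
Proof.
have q : fibred ph g (idm (src (idm u : H))) by rewrite src_idm.
by rewrite -(act_src p q); apply: act_congr => //; rewrite src_idm.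
Qed.

Lemma phi_src_act (g : G) u p : ph (src (act alpha g (idm u) p)) = tgt g.
Proof. exact: phi_act (src_act_idm p). Qed.

Lemma src_act (g : G) h (p : fibred ph g h) q :
  src (act alpha g h p) = src (act alpha g (idm (src h)) q).
Proof. by rewrite (act_src p q) src_idm. Qed.

Lemma tgt_act (g : G) h (p : fibred ph g h) q :
  tgt (act alpha g h p) = src (act alpha g (idm (tgt h)) q).
Proof. by rewrite (act_tgt p q) src_idm. Qed.

(** The object [alpha_g(u)]. *)
Definition actobj (g : G) (u : obj H) (e : src g = ph u) : obj H :=
  src (act alpha g (idm u) (fibred_idm e)).

Lemma actobj_congr (g g' : G) u u' e e' :
  g = g' -> u = u' -> @actobj g u e = @actobj g' u' e'.
Proof.
move=> gg uu; move: e e'; rewrite gg uu => e e'.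
by rewrite (Prop_irrelevance e e').
Qed.

Lemma phi_actobj (g : G) u e : ph (@actobj g u e) = tgt g.
Proof. exact: phi_src_act. Qed.

Lemma src_actE (g : G) h p e : src (act alpha g h p) = @actobj g (src h) e.
Proof. exact: src_act. Qed.

Lemma tgt_actE (g : G) h p e : tgt (act alpha g h p) = @actobj g (tgt h) e.
Proof. exact: tgt_act. Qed.

Lemma actobj_id a u e : @actobj (idm a) u e = u.
Proof.
have ea : ph (tgt (idm u : H)) = a by rewrite tgt_idm -e src_idm.
have p : fibred ph (idm (ph (tgt (idm u : H)))) (idm u).
  by split; rewrite ?src_idm ?tgt_idm.
rewrite /actobj -[RHS](@src_idm H); congr (src _).
by rewrite -[RHS](act_id p); apply: act_congr; rewrite ?ea.
Qed.

Lemma actobj_actobj (g' g : G) u (e : src g = ph u)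
    (e' : src g' = ph (actobj e)) (c : src g' = tgt g)
    (r : src (comp g' g c) = ph u) :
  actobj e' = actobj r.
Proof.
have q : fibred ph g' (act alpha g (idm u) (fibred_idm e)).
  by rewrite src_act_idm; apply: fibred_idm.
rewrite /actobj -(act_act q (fibred_idm r)); congr (src _).
by apply: act_congr; rewrite // -src_act_idm.
Qed.

Lemma sd_src_dom x : src (inv (sval x).2) = ph (src (sval x).1).
Proof. by rewrite src_inv; case: (svalP x). Qed.

Definition sdsrc x : obj H := actobj (sd_src_dom x).

Definition sdtgt x : obj H := tgt (sval x).1.

Lemma sdidm_subproof (u : obj H) :
  tgt (idm (ph u)) = ph (src (idm u : H)) /\
  ph (src (idm u : H)) = ph (tgt (idm u : H)).
Proof. by rewrite src_idm !tgt_idm. Qed.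

Definition sdidm (u : obj H) : sdmor :=
  exist _ ((idm u : mor H), (idm (ph u) : mor G)) (sdidm_subproof u).

Section Comp.
Variables (x y : sdmor) (e : sdsrc x = sdtgt y).

Lemma sd_phi_tgt : ph (tgt (sval y).1) = src (sval x).2.
Proof. by rewrite -[tgt _]e /sdsrc phi_actobj tgt_inv. Qed.

Lemma sd_gg : src (sval x).2 = tgt (sval y).2.
Proof. by rewrite -sd_phi_tgt; case: (svalP y) => -> ->. Qed.

Lemma sd_fib : fibred ph (sval x).2 (sval y).1.
Proof. by split; [rewrite sd_phi_tgt | case: (svalP y)]. Qed.

Lemma sd_hh : src (sval x).1 = tgt (act alpha (sval x).2 (sval y).1 sd_fib).
Proof.
have e1 : src (sval x).2 = ph (tgt (sval y).1) by rewrite sd_phi_tgt.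
rewrite (tgt_actE _ e1).
have e2 : src (sval x).2 = ph (sdsrc x) by rewrite e.
have c : src (sval x).2 = tgt (inv (sval x).2) by rewrite tgt_inv.
have r : src (comp (sval x).2 (inv (sval x).2) c) = ph (src (sval x).1).
  by rewrite src_comp sd_src_dom.
have -> : actobj e1 = actobj e2 by apply: actobj_congr; rewrite ?e.
rewrite (actobj_actobj e2 r).
have r' : src (idm (tgt (sval x).2)) = ph (src (sval x).1).
  by rewrite src_idm; case: (svalP x).
by rewrite -[LHS](actobj_id r'); apply: actobj_congr; rewrite ?comp_inv.
Qed.

Lemma sdcomp_subproof
  (hg := (comp _ _ sd_hh, comp _ _ sd_gg) : H * G) :
  tgt hg.2 = ph (src hg.1) /\ ph (src hg.1) = ph (tgt hg.1).
Proof.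
have e1 : src (sval x).2 = ph (src (sval y).1).
  by case: sd_fib => -> ->.
rewrite /hg /= !tgt_comp src_comp (src_actE _ e1) phi_actobj.
by case: (svalP x) => <- <-.
Qed.

(** (h, g)(h', g') = (h alpha_g(h'), gg') *)
Definition sdcomp : sdmor :=
  exist _ ((comp (sval x).1 (act alpha (sval x).2 (sval y).1 sd_fib) sd_hh,
            comp (sval x).2 (sval y).2 sd_gg) : H * G) sdcomp_subproof.

End Comp.

Lemma sd_inj x y :
  (sval x).1 = (sval y).1 -> (sval x).2 = (sval y).2 -> x = y.
Proof.
move=> e1 e2; apply: sig_inj.
by rewrite [LHS]surjective_pairing e1 e2 -surjective_pairing.
Qed.

Lemma inv_unique (g k : G) (e : src g = tgt k) :
  comp g k e = idm (tgt g) -> k = inv g.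
Proof.
move=> gk.
have ig : src (inv g) = tgt g by rewrite src_inv.
have e1 : src (comp (inv g) g ig) = tgt k by rewrite src_comp.
have e2 : src (inv g) = tgt (comp g k e) by rewrite tgt_comp.
have := compA e1 e2.
have e3 : src (idm (tgt k)) = tgt k by rewrite src_idm.
have e4 : src (inv g) = tgt (idm (src (inv g))) by rewrite tgt_idm.
rewrite (@comp_congr _ _ (idm (tgt k)) _ k _ e3) //; last first.
  by rewrite inv_comp e.
rewrite (@comp_congr _ (inv g) (inv g) _ (idm (src (inv g))) _ e4) //.
  by rewrite comp_idl comp_idr.
by rewrite gk src_inv.
Qed.

Lemma sdsrc_idm u : sdsrc (sdidm u) = u.
Proof.
have e : src (idm (ph u)) = ph u by rewrite src_idm.
rewrite -[RHS](actobj_id e); apply: actobj_congr; rewrite /= ?src_idm //.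
have t : src (idm (ph u)) = tgt (idm (ph u)) by rewrite src_idm tgt_idm.
have t' : src (idm (tgt (idm (ph u)))) = tgt (idm (ph u)) by rewrite src_idm.
apply/esym/(@inv_unique _ _ t); rewrite tgt_idm -[RHS](comp_idl t').
by apply: comp_congr; rewrite ?tgt_idm.
Qed.

Lemma sdtgt_idm u : sdtgt (sdidm u) = u.
Proof. exact: tgt_idm. Qed.

Lemma sdtgt_comp x y (e : sdsrc x = sdtgt y) : sdtgt (sdcomp e) = sdtgt x.
Proof. exact: tgt_comp. Qed.

Lemma inv_compM (g k : G) (e : src g = tgt k)
    (e' : src (inv k) = tgt (inv g)) :
  inv (comp g k e) = comp (inv k) (inv g) e'.
Proof.
have ki : src k = tgt (inv k) by rewrite tgt_inv.
have gi : src g = tgt (inv g) by rewrite tgt_inv.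
have c1 : src (comp k (inv k) ki) = tgt (inv g) by rewrite src_comp.
have c2 : src k = tgt (comp (inv k) (inv g) e') by rewrite tgt_comp.
have c3 : src g = tgt (comp k (comp (inv k) (inv g) e') c2).
  by rewrite tgt_comp.
have c4 : src (comp g k e) = tgt (comp (inv k) (inv g) e').
  by rewrite src_comp.
apply/esym/(@inv_unique _ _ c4).
rewrite (compA c4 c3) tgt_comp -(comp_inv gi); apply: comp_congr => //.
rewrite -(compA c1 c2).
have c5 : src (idm (tgt (inv g))) = tgt (inv g) by rewrite src_idm.
rewrite -[RHS](comp_idl c5); apply: comp_congr => //.
by rewrite comp_inv tgt_inv e.
Qed.

Lemma sdsrc_comp x y (e : sdsrc x = sdtgt y) : sdsrc (sdcomp e) = sdsrc y.
Proof.
set g := (sval x).2; set g' := (sval y).2.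
have c : src (inv g') = tgt (inv g) by rewrite src_inv tgt_inv (sd_gg e).
have c' : src (inv g) = tgt g by rewrite src_inv.
have a1 : src g = ph (src (sval y).1) by case: (sd_fib e) => -> ->.
have a2 : src (inv g) = ph (actobj a1) by rewrite phi_actobj.
have a3 : src (comp (inv g) g c') = ph (src (sval y).1) by rewrite src_comp.
have a4 : src (inv g') = ph (actobj a2) by rewrite phi_actobj.
have a5 : src (comp (inv g') (inv g) c) = ph (actobj a1).
  by rewrite src_comp.
have a6 : src (idm (src g)) = ph (src (sval y).1) by rewrite src_idm.
rewrite /sdsrc (@actobj_congr _ (comp (inv g') (inv g) c) _ (actobj a1) _ a5).
- rewrite -(actobj_actobj a4 a5); apply: actobj_congr => //.
  rewrite (actobj_actobj a2 a3) -[RHS](actobj_id a6).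
  by apply: actobj_congr; rewrite ?inv_comp.
- exact: inv_compM.
- by rewrite /= src_comp (src_actE _ a1).
Qed.

Lemma sdcomp_idl x (e : sdsrc (sdidm (sdtgt x)) = sdtgt x) : sdcomp e = x.
Proof.
have et : tgt (sval x).2 = ph (tgt (sval x).1) by case: (svalP x) => -> ->.
have p : fibred ph (idm (ph (tgt (sval x).1))) (sval x).1.
  by split; rewrite ?src_idm //; case: (svalP x).
have i1 : src (idm (tgt (sval x).1)) = tgt (sval x).1 by rewrite src_idm.
have i2 : src (idm (tgt (sval x).2)) = tgt (sval x).2 by rewrite src_idm.
apply: sd_inj => /=.
- rewrite -[RHS](comp_idl i1); apply: comp_congr => //.
  by rewrite -[RHS](act_id p); apply: act_congr.
- by rewrite -[RHS](comp_idl i2); apply: comp_congr; rewrite // et.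
Qed.

Lemma sdcomp_idr x (e : sdsrc x = sdtgt (sdidm (sdsrc x))) : sdcomp e = x.
Proof.
have i1 : src (sval x).1 = tgt (idm (src (sval x).1)) by rewrite tgt_idm.
have i2 : src (sval x).2 = tgt (idm (src (sval x).2)) by rewrite tgt_idm.
apply: sd_inj => /=.
- rewrite -[RHS](comp_idr i1); apply: comp_congr => //.
  by rewrite (sd_hh e) /= src_act_idm tgt_idm.
- rewrite -[RHS](comp_idr i2); apply: comp_congr => //.
  by rewrite phi_actobj tgt_inv.
Qed.

Lemma sdcompA x y z (xy : sdsrc x = sdtgt y) (yz : sdsrc y = sdtgt z)
    (e1 : sdsrc (sdcomp xy) = sdtgt z) (e2 : sdsrc x = sdtgt (sdcomp yz)) :
  sdcomp e1 = sdcomp e2.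
Proof.
set g := (sval x).2; set h' := (sval y).1; set g' := (sval y).2.
set h'' := (sval z).1.
have p : fibred ph g' h'' by exact: sd_fib.
have r : fibred ph (comp g g' (sd_gg xy)) h'' by exact: (sd_fib e1).
have q : fibred ph g (act alpha g' h'' p).
  have b1 : src g' = ph (tgt h'') by case: p.
  have b2 : src g' = ph (src h'') by case: p => -> ->.
  split; last by rewrite (tgt_actE _ b1) (src_actE _ b2) !phi_actobj.
  by rewrite (tgt_actE _ b1) phi_actobj; apply: (sd_gg xy).
have p' : fibred ph g h' by exact: sd_fib.
have hA : src h' = tgt (act alpha g' h'' p).
  by rewrite (sd_hh yz); congr tgt; apply: act_congr.
have rA : fibred ph g (comp h' (act alpha g' h'' p) hA).
  case: p' q => a _ [c d].
  by rewrite /fibred tgt_comp src_comp; split; rewrite // -d -c a.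
have cA : src (act alpha g h' p') = tgt (act alpha g _ q).
  have b1 : src g = ph (src h') by case: p' => -> ->.
  have b2 : src g = ph (tgt (act alpha g' h'' p)) by case: q.
  by rewrite (src_actE _ b1) (tgt_actE _ b2); apply: actobj_congr.
apply: sd_inj => /=; last exact: compA.
have d1 : src (sval x).1 = tgt (act alpha g h' p').
  by rewrite (sd_hh xy); congr tgt; apply: act_congr.
have d2 : src (comp (sval x).1 (act alpha g h' p') d1)
        = tgt (act alpha g (act alpha g' h'' p) q) by rewrite src_comp.
have d3 : src (sval x).1 = tgt (comp _ _ cA) by rewrite tgt_comp.
transitivity (comp _ _ d2).
  by apply: comp_congr; [apply: comp_congr => //; apply: act_congr
                        | rewrite (act_act q r); apply: act_congr].
rewrite (compA d2 d3); apply: comp_congr => //.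
rewrite -(act_comp rA cA); apply: act_congr => //.
by apply: comp_congr => //; apply: act_congr.
Qed.

Definition semidirect : smallCat :=
  SmallCat sdsrc_idm sdtgt_idm sdsrc_comp sdtgt_comp
    sdcomp_idl sdcomp_idr sdcompA.

End Semidirect.

(** The set of [h] with [phi (src h) = phi (tgt h)]. *)
Definition Hr (G H : smallCat) (alpha : catAction G H) : set H :=
  [set h : H | phi alpha (src h) = phi alpha (tgt h)].

(** * C*-algebras

    Not necessarily unital, over the complex numbers [R[i]]; the norm takes its
    values in the nonnegative reals inside [R[i]]. *)

Record cstarAlg (R : realType) : Type := CstarAlg {
  cstar_sort :> completeNormedModType R[i];
  cmul : cstar_sort -> cstar_sort -> cstar_sort;
  star : cstar_sort -> cstar_sort;
  cmulA : forall x y z, cmul x (cmul y z) = cmul (cmul x y) z;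
  cmulDl : forall x y z, cmul (x + y) z = cmul x z + cmul y z;
  cmulDr : forall x y z, cmul x (y + z) = cmul x y + cmul x z;
  cmulZl : forall (a : R[i]) x y, cmul (a *: x) y = a *: cmul x y;
  cmulZr : forall (a : R[i]) x y, cmul x (a *: y) = a *: cmul x y;
  starD : forall x y, star (x + y) = star x + star y;
  starZ : forall (a : R[i]) x, star (a *: x) = Num.conj a *: star x;
  starM : forall x y, star (cmul x y) = cmul (star y) (star x);
  starK : forall x, star (star x) = x;
  cnormM : forall x y, `|cmul x y| <= `|x| * `|y|;
  cnorm_star : forall x, `|cmul (star x) x| = `|x| ^+ 2
}.

Declare Scope cstar_scope.
Delimit Scope cstar_scope with cstar.
Notation "x ⋅ y" := (cmul x y) (at level 40, left associativity) : cstar_scope.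
Notation "x ^⋆" := (star x) (at level 2, format "x ^⋆") : cstar_scope.
Local Open Scope cstar_scope.

Definition unital (R : realType) (B : cstarAlg R) : Prop :=
  exists e : B, forall x : B, e ⋅ x = x /\ x ⋅ e = x.

Record star_hom (R : realType) (A B : cstarAlg R) (f : A -> B) : Prop :=
  StarHom {
    star_hom_linear : linear f;
    star_hom_mul : forall x y, f (x ⋅ y) = f x ⋅ f y;
    star_hom_star : forall x, f (x^⋆) = (f x)^⋆
  }.

Definition star_isomorphic (R : realType) (A B : cstarAlg R) : Prop :=
  exists f : A -> B, star_hom f /\ bijective f.

Record star_subalgebra (R : realType) (A : cstarAlg R) (D : set A) : Prop :=
  StarSubalgebra {
    star_sub0 : D 0;
    star_subD : forall x y, D x -> D y -> D (x + y);
    star_subZ : forall (a : R[i]) x, D x -> D (a *: x);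
    star_subM : forall x y, D x -> D y -> D (x ⋅ y);
    star_sub_star : forall x, D x -> D (x^⋆)
  }.

(** The C*-subalgebra generated by [X] is all of [A]. *)
Definition cstar_generated (R : realType) (A : cstarAlg R) (X : set A) : Prop :=
  forall D : set A, star_subalgebra D -> closed D -> X `<=` D -> D = setT.

Definition partial_isometry (R : realType) (A : cstarAlg R) (v : A) : Prop :=
  v ⋅ v^⋆ ⋅ v = v.

(** * The C*-algebra of a small category *)

Section Rep.
Variables (R : realType) (L : smallCat) (B : cstarAlg R) (S : L -> B).

Definition Qproj (f : L) : B := (S f)^⋆ ⋅ S f.
Definition Pproj (f : L) : B := S f ⋅ (S f)^⋆.

Record representation : Prop := Representation {
  rep_pisom : forall f, partial_isometry (S f);
  rep_comp : forall f g (e : src f = tgt g), S f ⋅ S g = S (comp f g e);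
  rep_ncomp : forall f g, src f <> tgt g -> S f ⋅ S g = 0;
  rep_commQQ : forall f g, Qproj f ⋅ Qproj g = Qproj g ⋅ Qproj f;
  rep_commPP : forall f g, Pproj f ⋅ Pproj g = Pproj g ⋅ Pproj f;
  rep_commQP : forall f g, Qproj f ⋅ Pproj g = Pproj g ⋅ Qproj f;
  rep_disjoint : forall f g, perp f g -> Pproj f ⋅ Pproj g = 0;
  rep_QP : forall f g, src f = tgt g -> Qproj f ⋅ Pproj g = Pproj g
}.

End Rep.

(** [A], with the partial isometries [S f], is C*([L]). [A] itself need not be
    unital; the relations make sense in it nonetheless. *)
Record is_cstar_of (R : realType) (L : smallCat) (A : cstarAlg R)
    (S : L -> A) : Prop := IsCstarOf {
  cstar_of_rep : representation S;
  cstar_of_gen : cstar_generated (range S);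
  cstar_of_univ : forall (B : cstarAlg R) (T : L -> B),
    unital B -> representation T ->
    exists! p : A -> B, star_hom p /\ forall f, p (S f) = T f
}.

(* Main.v *)
(** The two semi-direct products have the same morphisms, because [(h, g)] lies
    in one only if [phi (src h) = phi (tgt h)]; it remains to see that the
    universal property determines the C*-algebra although it only quantifies
    over unital targets. Given another such algebra [B], one maps into its
    unitization [B + C]. The component in [C], composed with the inclusion of
    [C] in [B + C], is a *-homomorphism killing the generators, hence it is zero
    by uniqueness, and the map lands in [B]. No automatic continuity of
    *-homomorphisms is needed. *)

Require Import Defs.
From HB Require Import structures.
From mathcomp Require Import all_boot all_order all_algebra.
From mathcomp Require Import all_classical all_reals topology normedtype.
From mathcomp Require Import complex.
(* Restores [comp] of small categories, hidden by function composition. *)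
Import Defs.

Set Implicit Arguments.
Unset Strict Implicit.
Unset Printing Implicit Defensive.

Import Order.TTheory GRing.Theory Num.Theory.
Import numFieldNormedType.Exports.

Local Open Scope classical_set_scope.
Local Open Scope ring_scope.
Local Open Scope cstar_scope.
Local Open Scope complex_scope.

(** * Completeness of the complex numbers *)

Lemma complex_ge0_real (R : rcfType) (x : R[i]) :
  0 <= x -> x = (complex.Re x)%:C.
Proof. by move=> x0; rewrite RRe_real ?ger0_real. Qed.

Lemma normc_i (R : rcfType) : `|'i : R[i]| = 1.
Proof. by rewrite normc_def /= expr0n expr1n add0r sqrtr1. Qed.

Lemma normc_real (R : rcfType) (x : R) : `|x%:C| = `|x|%:C.
Proof. by rewrite normc_def /= expr0n addr0 sqrtr_sqr. Qed.

(** Real and imaginary parts are 1-Lipschitz, so they carry a Cauchy filter to convergent filters on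
    [R]. This supplies the scalar coordinate in the completeness of the unitization. *)
Lemma complex_cauchy_cvg (R : realType) (F : set_system R[i]^o) :
  ProperFilter F -> cauchy F -> cvg F.
Proof.
move=> FF /cauchyP Fc.
have part_cvg (f : R[i]^o -> R) : (forall x y, `|f x - f y|%:C <= `|x - y|) ->
    cvg (f @ F).
  move=> f_lip; apply/cauchy_cvgP/cauchy_exP => e e0.
  have e0' : 0 < e%:C by rewrite ltcR.
  have [x Fx] := Fc _ e0'; exists (f x).
  suff : F [set y | ball (f x) e (f y)] by [].
  apply: filterS Fx => y; rewrite -!ball_normE /= -ltcR.
  exact: le_lt_trans (f_lip x y).
have /cvg_ex[a /cvgrPdist_lt aP] : cvg (@complex.Re R @ F).
  by apply: part_cvg => x y; rewrite -raddfB normc_ge_Re.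
have /cvg_ex[b /cvgrPdist_lt bP] : cvg (@complex.Im R @ F).
  (* Up to sign, the imaginary part is the real part of a multiple by ['i], which has modulus 1. *)
  apply: part_cvg => x y; rewrite -raddfB -normrN -ReiNIm.
  by apply: le_trans (normc_ge_Re _) _; rewrite normrM normc_i mulr1.
apply/cvg_ex; exists (a +i* b); apply/cvgrPdist_lt => e e0.
have er := complex_ge0_real (ltW e0); move: e0; rewrite er ltcR => e0.
have e2 : 0 < complex.Re e / 2 by rewrite divr_gt0.
near=> y.
have -> : a +i* b - y = (a - complex.Re y)%:C + 'i * (b - complex.Im y)%:C.
  by rewrite [LHS]complexE; case: (y).
apply: le_lt_trans (ler_normD _ _) _.
rewrite normrM normc_i mul1r !normc_real [complex.Re e]splitr rmorphD /=.
by apply: ltrD; rewrite ltcR; near: y; [exact: aP _ e2 | exact: bP _ e2].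
Unshelve. all: by end_near. Qed.

(** * Zero and adjoints in a C*-algebra *)

Section CstarTheory.
Variables (R : realType) (B : cstarAlg R).
Implicit Types x y : B.

Lemma cmul0l x : 0 ⋅ x = 0.
Proof. by rewrite -[X in X ⋅ _](scale0r (0 : B)) cmulZl scale0r. Qed.

Lemma cmul0r x : x ⋅ 0 = 0.
Proof. by rewrite -[X in _ ⋅ X](scale0r (0 : B)) cmulZr scale0r. Qed.

Lemma star0 : (0 : B)^⋆ = 0.
Proof. by rewrite -[X in X^⋆](scale0r (0 : B)) starZ conjC0 scale0r. Qed.

(** The C*-identity and submultiplicativity bound the square of the norm of y by the product of the
    norms of y* and y; cancel one factor, then exchange y and y*. *)
Lemma cnorm_starE x : `|x^⋆| = `|x|.
Proof.
suff star_ge y : `|y| <= `|y^⋆|.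
  by apply/le_anti; rewrite star_ge andbT; have := star_ge x^⋆; rewrite starK.
have [->|y0] := eqVneq y 0; first by rewrite star0.
by rewrite -(@ler_pM2r _ `|y|) ?normr_gt0// -expr2 -cnorm_star cnormM.
Qed.

End CstarTheory.

(** * Unitization of a C*-algebra *)

Definition unitization (R : realType) (B : cstarAlg R) : Type :=
  (B * R[i]^o)%type.

(** Only the module structure of the product is copied, which leaves room for a norm other than the
    maximum of the coordinate norms. *)
HB.instance Definition _ (R : realType) (B : cstarAlg R) :=
  GRing.Lmodule.copy (unitization B) (B * R[i]^o)%type.

Section Unitization.
Variables (R : realType) (B : cstarAlg R).
Implicit Types (u v : unitization B) (x y : B) (c : R[i]).

(** Left multiplication by b + l on the ideal [B] of the unitization. *)
Definition uact u x : B := u.1 ⋅ x + u.2 *: x.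

Definition umul u v : unitization B :=
  (u.1 ⋅ v.1 + u.2 *: v.1 + v.2 *: u.1, u.2 * v.2).

Definition ustar u : unitization B := (u.1^⋆, u.2^*)%R.

Lemma uactDl u v x : uact (u + v) x = uact u x + uact v x.
Proof. by rewrite /uact cmulDl scalerDl addrACA. Qed.

Lemma uactZl c u x : uact (c *: u) x = c *: uact u x.
Proof. by rewrite /uact cmulZl scalerDr scalerA. Qed.

Lemma uact0r u : uact u 0 = 0.
Proof. by rewrite /uact cmul0r scaler0 addr0. Qed.

Lemma uactM u v x : uact (umul u v) x = uact u (uact v x).
Proof.
rewrite /uact /umul /= !cmulDl !cmulDr !cmulZl !cmulZr cmulA scalerDr scalerA.
by rewrite -!addrA; congr (_ + _); rewrite addrCA.
Qed.

Lemma star_uact u x y : (uact u x)^⋆ ⋅ y = x^⋆ ⋅ uact (ustar u) y.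
Proof.
by rewrite /uact starD starM starZ cmulDl cmulDr cmulZl cmulZr cmulA.
Qed.

Lemma umulA u v w : umul u (umul v w) = umul (umul u v) w.
Proof.
congr (_, _); last exact: mulrA.
rewrite /= !(cmulDl, cmulDr, cmulZl, cmulZr, scalerDr, scalerA, cmulA).
rewrite (mulrC w.2) (mulrC w.2) -!addrA; congr (_ + _).
rewrite [RHS]addrCA; congr (_ + _).
by rewrite addrCA; congr (_ + _); rewrite addrCA.
Qed.

Definition unorm_bound u : set R :=
  [set r | `|u.2| <= r%:C /\ forall x, `|uact u x| <= r%:C * `|x|].

(* The maximum of [|l|] and the operator norm of [x |-> b x + l x]. The term
   [|l|] makes this a norm even when [B] has a unit. *)
Definition unorm u : R[i] := (inf (unorm_bound u))%:C.

Lemma unorm_bound_ge0 u r : unorm_bound u r -> 0 <= r.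
Proof. by case=> /(le_trans (normr_ge0 _)) + _; rewrite ler0c. Qed.

Lemma unorm_bound_nonempty u : unorm_bound u !=set0.
Proof.
exists (complex.Re (`|u.1| + `|u.2|)).
rewrite /unorm_bound /= -complex_ge0_real ?addr_ge0//.
split=> [|x]; first by rewrite lerDr.
rewrite mulrDl; apply: le_trans (ler_normD _ _) _.
by rewrite normrZ lerD2r cnormM.
Qed.

Lemma unorm_ge u c : (forall r, unorm_bound u r -> c <= r%:C) -> 0 <= c ->
  c <= unorm u.
Proof.
move=> c_le c0; rewrite (complex_ge0_real c0) lecR.
apply: lb_le_inf; first exact: unorm_bound_nonempty.
by move=> r /c_le; rewrite {1}(complex_ge0_real c0) lecR.
Qed.

Lemma unorm_ge0 u : 0 <= unorm u.
Proof. by apply: unorm_ge => // r /unorm_bound_ge0; rewrite ler0c. Qed.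

Lemma unorm_scalar u : `|u.2| <= unorm u.
Proof. by apply: unorm_ge => // r []. Qed.

(** The infimum is itself a bound: for nonzero x, every admissible r dominates the quotient of the
    two norms. *)
Lemma unorm_act u x : `|uact u x| <= unorm u * `|x|.
Proof.
have [->|x0] := eqVneq x 0; first by rewrite uact0r !normr0 mulr0.
have x0' : 0 < `|x| by rewrite normr_gt0.
rewrite -ler_pdivrMr//; apply: unorm_ge; last exact: divr_ge0.
by move=> r [_ act_le]; rewrite ler_pdivrMr.
Qed.

Lemma unorm_le u c : `|u.2| <= c -> (forall x, `|uact u x| <= c * `|x|) ->
  unorm u <= c.
Proof.
move=> scalar_le act_le.
(* The bound on the scalar part already makes c nonnegative, hence real. *)
have c0 : 0 <= c by apply: le_trans scalar_le.
move: scalar_le act_le; rewrite (complex_ge0_real c0) => scalar_le act_le.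
rewrite lecR; apply: ge_inf; last by split.
by exists 0 => r /unorm_bound_ge0.
Qed.

Lemma unormD u v : unorm (u + v) <= unorm u + unorm v.
Proof.
apply: unorm_le => [|x].
  by apply: le_trans (ler_normD _ _) _; rewrite lerD ?unorm_scalar.
rewrite uactDl mulrDl; apply: le_trans (ler_normD _ _) _.
by rewrite lerD ?unorm_act.
Qed.

Lemma unormZ c u : unorm (c *: u) = `|c| * unorm u.
Proof.
have unormZ_le k v : unorm (k *: v) <= `|k| * unorm v.
  apply: unorm_le => [|x].
    by rewrite normrM ler_wpM2l ?unorm_scalar.
  by rewrite uactZl normrZ -mulrA ler_wpM2l ?unorm_act.
apply/le_anti; rewrite unormZ_le /=.
have [->|c0] := eqVneq c 0; first by rewrite normr0 mul0r unorm_ge0.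
(* The reverse inequality is the first one applied to the inverse scalar. *)
rewrite -ler_pdivlMl ?normr_gt0// -normfV.
by apply: le_trans (unormZ_le _ _); rewrite scalerA mulVf// scale1r.
Qed.

(** The scalar part vanishes because the norm dominates it; evaluating at b* then makes the norm of
    b b*, which is the square of that of b, vanish. *)
Lemma unorm_eq0 u : unorm u = 0 -> u = 0.
Proof.
case: u => b l u0; have := unorm_scalar (b, l).
rewrite u0 normr_le0 => /eqP /= l0; move: u0; rewrite l0 => u0.
have := unorm_act (b, 0) b^⋆.
rewrite u0 mul0r /uact /= scale0r addr0 -{1}[b]starK cnorm_star cnorm_starE.
move=> b_le0; have : `|b| ^+ 2 == 0 by rewrite eq_le b_le0 exprn_ge0.
by rewrite sqrf_eq0 normr_eq0 => /eqP ->.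
Qed.

HB.instance Definition _ :=
  @Lmodule_isNormed.Build R[i] (unitization B) unorm unormD unormZ unorm_eq0.

Lemma unit_normE u : `|u| = unorm u. Proof. by []. Qed.

Lemma unit_norm_le u : `|u| <= `|u.1| + `|u.2|.
Proof.
rewrite unit_normE; apply: unorm_le => [|x]; first by rewrite lerDr.
rewrite mulrDl; apply: le_trans (ler_normD _ _) _.
by rewrite normrZ lerD2r cnormM.
Qed.

(** For u = b + l, write b b* as u b* - l b*; each of the two terms has norm at most the product of
    the norms of u and b. *)
Lemma unit_norm_fst u : `|u.1| <= 2 * `|u|.
Proof.
have [->|b0] := eqVneq u.1 0; first by rewrite normr0 mulr_ge0.
have b0' : 0 < `|u.1| by rewrite normr_gt0.
rewrite -(ler_pM2r b0').
have -> : `|u.1| * `|u.1| = `|uact u u.1^⋆ - u.2 *: u.1^⋆|.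
  by rewrite /uact addrK -{3}[u.1]starK cnorm_star cnorm_starE expr2.
rewrite mulr_natl mulr2n mulrDl; apply: le_trans (ler_normB _ _) _.
rewrite normrZ -(cnorm_starE u.1); apply: lerD; first exact: unorm_act.
by rewrite ler_wpM2r// unorm_scalar.
Qed.

(** The norm is equivalent to the sum of the coordinate norms, so limits can be taken in each
    coordinate. *)
Lemma unitization_complete (F : set_system (unitization B)) :
  ProperFilter F -> cauchy F -> cvg F.
Proof.
move=> FF /cauchyP Fc.
have /cvg_ex[b /cvgrPdist_lt bP] : cvg (@fst B R[i]^o @ F).
  apply/cauchy_cvgP/cauchy_exP => e e0.
  (* Half the radius absorbs the factor 2 of [unit_norm_fst]. *)
  have [u Fu] := Fc _ (divr_gt0 e0 (ltr0n _ 2)); exists u.1.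
  suff : F [set v | ball u.1 e v.1] by [].
  apply: filterS Fu => v; rewrite -!ball_normE /= => uv.
  apply: le_lt_trans (unit_norm_fst (u - v)) _.
  by rewrite mulrC -ltr_pdivlMr.
have /cvg_ex[l /cvgrPdist_lt lP] : cvg (@snd B R[i]^o @ F).
  apply: complex_cauchy_cvg; apply/cauchy_exP => e e0.
  have [u Fu] := Fc _ e0; exists u.2.
  suff : F [set v | ball u.2 e v.2] by [].
  apply: filterS Fu => v; rewrite -!ball_normE /=.
  exact: le_lt_trans (unorm_scalar (u - v)).
apply/cvg_ex; exists ((b, l) : unitization B); apply/cvgrPdist_lt => e e0.
have e2 : 0 < e / 2 by rewrite divr_gt0.
near=> u; apply: le_lt_trans (unit_norm_le _) _.
by rewrite [e]splitr; apply: ltrD; near: u; [exact: bP | exact: lP].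
Unshelve. all: by end_near. Qed.

HB.instance Definition _ :=
  Uniform_isComplete.Build (unitization B) unitization_complete.

Lemma umulDl u v w : umul (u + v) w = umul u w + umul v w.
Proof.
congr (_, _); last exact: mulrDl.
by rewrite /= cmulDl scalerDl scalerDr [X in X + _]addrACA [LHS]addrACA.
Qed.

Lemma umulDr u v w : umul u (v + w) = umul u v + umul u w.
Proof.
congr (_, _); last exact: mulrDr.
by rewrite /= cmulDr scalerDl scalerDr [X in X + _]addrACA [LHS]addrACA.
Qed.

Lemma umulZl c u v : umul (c *: u) v = c *: umul u v.
Proof.
congr (_, _); last by rewrite /= -mulrA.
by rewrite /= cmulZl !scalerDr !scalerA mulrC.
Qed.

Lemma umulZr c u v : umul u (c *: v) = c *: umul u v.
Proof.
congr (_, _); last by rewrite /= mulrCA.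
by rewrite /= cmulZr !scalerDr !scalerA mulrC.
Qed.

Lemma ustarD u v : ustar (u + v) = ustar u + ustar v.
Proof. by congr (_, _); rewrite /= ?starD ?rmorphD. Qed.

Lemma ustarZ c u : ustar (c *: u) = Num.conj c *: ustar u.
Proof. by congr (_, _); rewrite /= ?starZ ?rmorphM. Qed.

Lemma ustarM u v : ustar (umul u v) = umul (ustar v) (ustar u).
Proof.
congr (_, _); last by rewrite /= mulrC rmorphM.
by rewrite /= !starD starM !starZ addrAC.
Qed.

Lemma ustarK u : ustar (ustar u) = u.
Proof. by case: u => b l; congr (_, _); rewrite /= ?starK ?conjCK. Qed.

Lemma unit_normM u v : `|umul u v| <= `|u| * `|v|.
Proof.
rewrite [leLHS]unit_normE; apply: unorm_le => [|x].
  by rewrite normrM ler_pM ?unorm_scalar.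
rewrite uactM -mulrA; apply: le_trans (unorm_act _ _) _.
by rewrite ler_wpM2l ?unorm_act ?unorm_ge0.
Qed.

(** Since (v x)* (v x) = x* (v* v x), the C*-identity of [B] bounds the square of the norm of v by
    the norm of v* v. With submultiplicativity this makes the star isometric and gives the other
    inequality. *)
Lemma unit_norm_star u : `|umul (ustar u) u| = `|u| ^+ 2.
Proof.
have norm_sqr v : `|v| ^+ 2 <= `|umul (ustar v) v|.
  (* Square roots are taken so that [unorm_le] applies, with the root of the norm of v* v as the
     constant. *)
  rewrite -[leRHS]sqrtCK ler_sqr ?nnegrE ?sqrtC_ge0//.
  rewrite unit_normE; apply: unorm_le => [|x].
    rewrite -(@ler_sqr R[i]) ?nnegrE ?sqrtC_ge0// sqrtCK.
    apply: le_trans (unorm_scalar _).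
    by rewrite /= normrM norm_conjC expr2.
  rewrite -(@ler_sqr R[i]) ?nnegrE ?mulr_ge0 ?sqrtC_ge0// exprMn sqrtCK.
  rewrite -cnorm_star star_uact -uactM; apply: le_trans (cnormM _ _) _.
  by rewrite cnorm_starE expr2 mulrCA ler_wpM2l// unorm_act.
have star_ge v : `|v| <= `|ustar v|.
  have [->|v0] := eqVneq v 0; first by rewrite normr0.
  rewrite -(@ler_pM2r _ `|v|) ?normr_gt0// -expr2.
  exact: le_trans (norm_sqr v) (unit_normM _ _).
apply/le_anti; rewrite norm_sqr andbT.
apply: le_trans (unit_normM _ _) _.
by rewrite expr2 ler_wpM2r// -{2}(ustarK u) star_ge.
Qed.

Definition unitization_cstar : cstarAlg R :=
  CstarAlg umulA umulDl umulDr umulZl umulZr ustarD ustarZ ustarM ustarK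
    unit_normM unit_norm_star.

Lemma unitization_unital : unital unitization_cstar.
Proof.
exists ((0, 1) : unitization B) => -[b l]; split; congr (_, _);
  rewrite /= ?cmul0l ?cmul0r ?scaler0 ?scale1r ?mul1r ?mulr1 ?addr0 ?add0r//.
Qed.

Definition unit_embed x : unitization_cstar := (x, 0).

(** The scalar part is kept inside the unitization, so that no separate C*-algebra of complex
    numbers has to be built. *)
Definition unit_scalar (u : unitization_cstar) : unitization_cstar := (0, u.2).

Lemma unit_embed_inj : injective unit_embed. Proof. by move=> x y []. Qed.

Lemma unit_embed_hom : star_hom unit_embed.
Proof.
split=> [c x y|x y|x]; congr (_, _) => /=.
- by rewrite scaler0 addr0.
- by rewrite !scale0r !addr0.
- by rewrite mulr0.
- by rewrite conjC0.
Qed.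

Lemma unit_scalar_hom : star_hom unit_scalar.
Proof.
split=> [c x y|x y|x]; congr (_, _) => /=.
- by rewrite scaler0 addr0.
- by rewrite cmul0l !scaler0 !addr0.
- by rewrite star0.
Qed.

End Unitization.

(** * Homomorphisms and representations *)

Section StarHom.
Variables (R : realType) (A B C : cstarAlg R).

Lemma star_hom0 (f : A -> B) : star_hom f -> f 0 = 0.
Proof.
case=> f_lin _ _; have := f_lin (-1) 0 0.
by rewrite scaleN1r addNr scaleN1r addNr.
Qed.

Lemma star_hom_comp (f : A -> B) (g : B -> C) :
  star_hom f -> star_hom g -> star_hom (g \o f).
Proof.
move=> fh gh; split=> [c x y|x y|x] /=.
- by rewrite (star_hom_linear fh) (star_hom_linear gh).
- by rewrite (star_hom_mul fh) (star_hom_mul gh).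
- by rewrite (star_hom_star fh) (star_hom_star gh).
Qed.

Lemma star_hom_zero : star_hom (fun _ : A => 0 : B).
Proof.
by split=> [c x y|x y|x]; rewrite ?scaler0 ?addr0 ?cmul0l ?star0.
Qed.

Lemma star_hom_lift (f : A -> B) (g : B -> C) : injective g ->
  star_hom g -> star_hom (g \o f) -> star_hom f.
Proof.
move=> g_inj gh gfh; split=> [c x y|x y|x]; apply: g_inj.
- by rewrite (star_hom_linear gh); apply: (star_hom_linear gfh).
- by rewrite (star_hom_mul gh); apply: (star_hom_mul gfh).
- by rewrite (star_hom_star gh); apply: (star_hom_star gfh).
Qed.

Variable L : smallCat.

(** All the relations are identities between products, adjoints and 0, which a *-homomorphism
    preserves. *)
Lemma representation_hom (f : A -> B) (S : L -> A) :
  star_hom f -> representation S -> representation (f \o S).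
Proof.
move=> fh Srep.
have fQ g : Qproj (f \o S) g = f (Qproj S g).
  by rewrite /Qproj (star_hom_mul fh) (star_hom_star fh).
have fP g : Pproj (f \o S) g = f (Pproj S g).
  by rewrite /Pproj (star_hom_mul fh) (star_hom_star fh).
split=> [g|g k e|g k e|g k|g k|g k|g k gk|g k gk].
- rewrite /partial_isometry /= -(star_hom_star fh) -!(star_hom_mul fh).
  by rewrite (rep_pisom Srep).
- by rewrite /= -(star_hom_mul fh) (rep_comp Srep e).
- by rewrite /= -(star_hom_mul fh) (rep_ncomp Srep e) star_hom0.
- by rewrite !fQ -!(star_hom_mul fh) (rep_commQQ Srep).
- by rewrite !fP -!(star_hom_mul fh) (rep_commPP Srep).
- by rewrite fQ fP -!(star_hom_mul fh) (rep_commQP Srep).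
- by rewrite !fP -!(star_hom_mul fh) (rep_disjoint Srep gk) star_hom0.
- by rewrite fQ fP -!(star_hom_mul fh) (rep_QP Srep gk).
Qed.

End StarHom.

(** * Universal property for targets without a unit *)

(** After the embedding into the unitization, both maps solve the same universal problem with a
    unital target; the embedding is injective. *)
Lemma cstar_of_hom_eq (R : realType) (L : smallCat) (A B : cstarAlg R)
    (S : L -> A) (p q : A -> B) : is_cstar_of S -> star_hom p -> star_hom q ->
  (forall f, p (S f) = q (S f)) -> p =1 q.
Proof.
move=> SP ph qh pq x; apply: (@unit_embed_inj _ B).
have eh := unit_embed_hom B; have ph' := star_hom_comp ph eh.
have [r [_ r_uniq]] := cstar_of_univ SP (unitization_unital B)
  (representation_hom ph' (cstar_of_rep SP)).
have rp : r = @unit_embed _ B \o p by apply: r_uniq.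
have rq : r = @unit_embed _ B \o q.
  apply: r_uniq; split; first exact: star_hom_comp.
  by move=> f /=; rewrite pq.
by have := congr1 (@^~ x) (etrans (esym rp) rq).
Qed.

Lemma cstar_of_hom (R : realType) (L : smallCat) (A B : cstarAlg R)
    (S : L -> A) (T : L -> B) : is_cstar_of S -> representation T ->
  exists p : A -> B, star_hom p /\ forall f, p (S f) = T f.
Proof.
move=> SP Trep; have eh := unit_embed_hom B.
have [p [[ph pS] _]] := cstar_of_univ SP (unitization_unital B)
  (representation_hom eh Trep).
have p2 x : (p x).2 = 0.
  have sp_hom := star_hom_comp ph (unit_scalar_hom B).
  suff /(_ x) : unit_scalar (B := B) \o p =1 fun=> 0 by case.
  apply: (cstar_of_hom_eq SP) => //; first exact: star_hom_zero.
  by move=> f /=; rewrite pS.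
exists (fun x => (p x).1); split; last by move=> f; rewrite pS.
(* With a vanishing scalar part, embedding the first component gives back [p], so the first
   component inherits the homomorphism laws. *)
apply: (star_hom_lift (@unit_embed_inj _ B) eh).
suff -> : @unit_embed _ B \o (fun x => (p x).1) = p by [].
by apply/funext => x /=; rewrite /unit_embed -(p2 x) -surjective_pairing.
Qed.

(** Both composites of the two induced maps fix the generators, so they are identities. *)
Lemma cstar_of_unique (R : realType) (L : smallCat) (A B : cstarAlg R)
    (S : L -> A) (T : L -> B) :
  is_cstar_of S -> is_cstar_of T -> star_isomorphic A B.
Proof.
move=> SP TP.
have [p [ph pS]] := cstar_of_hom SP (cstar_of_rep TP).
have [q [qh qT]] := cstar_of_hom TP (cstar_of_rep SP).
have id_hom (C : cstarAlg R) : star_hom (@id C) by [].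
exists p; split=> //; exists q.
- apply: (cstar_of_hom_eq SP (star_hom_comp ph qh) (id_hom A)) => f /=.
  by rewrite pS qT.
- apply: (cstar_of_hom_eq TP (star_hom_comp qh ph) (id_hom B)) => f /=.
  by rewrite qT pS.
Qed.

(** * Isomorphisms of small categories *)

(** The data live on morphisms alone: the relations of a representation see the category only
    through composability, products and disjointness, so no map on objects is carried along. *)
Record cat_iso (L M : smallCat) (F : L -> M) (F' : M -> L) : Prop := CatIso {
  cat_isoK : cancel F F';
  cat_isoVK : cancel F' F;
  cat_iso_composable : forall f g, src f = tgt g <-> src (F f) = tgt (F g);
  cat_iso_comp : forall f g e e', F (comp f g e) = comp (F f) (F g) e'
}.

Lemma cat_iso_sym (L M : smallCat) (F : L -> M) (F' : M -> L) :
  cat_iso F F' -> cat_iso F' F.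
Proof.
move=> Fiso; have [FK F'K Fc Fm] := Fiso; split=> // [f g|f g e e'].
  by rewrite -[in src f](F'K f) -[in tgt g](F'K g); apply: iff_sym.
have e'' : src (F (F' f)) = tgt (F (F' g)) by rewrite !F'K.
by apply: (can_inj FK); rewrite F'K (Fm _ _ _ e''); apply: comp_congr.
Qed.

Section CatIso.
Variables (R : realType) (L M : smallCat) (F : L -> M) (F' : M -> L).
Hypothesis Fiso : cat_iso F F'.

(** A common multiple of the images pulls back along [F']. *)
Lemma perp_iso f g : perp f g -> perp (F f) (F g).
Proof.
move=> fg [h [k [eh [ek hk]]]]; apply: fg; exists (F' h), (F' k).
have F'K := cat_isoVK Fiso; have Fc := cat_iso_composable Fiso.
have fh : src f = tgt (F' h) by apply/Fc; rewrite F'K.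
have gk : src g = tgt (F' k) by apply/Fc; rewrite F'K.
have fh' : src (F f) = tgt (F (F' h)) by rewrite F'K.
have gk' : src (F g) = tgt (F (F' k)) by rewrite F'K.
exists fh, gk; apply: (can_inj (cat_isoK Fiso)).
rewrite (cat_iso_comp Fiso _ fh') (cat_iso_comp Fiso _ gk').
transitivity (comp (F f) h eh); first exact: comp_congr.
by rewrite hk; apply: comp_congr.
Qed.

Lemma representation_iso (B : cstarAlg R) (S : M -> B) :
  representation S -> representation (S \o F).
Proof.
move=> Srep; have Fc := cat_iso_composable Fiso.
split=> [f|f g e|f g e|f g|f g|f g|f g fg|f g fg].
- exact: rep_pisom Srep _.
- have e' := (Fc f g).1 e.
  by rewrite /= (rep_comp Srep e') (cat_iso_comp Fiso e e').
- by apply: (rep_ncomp Srep) => /Fc.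
- exact: (rep_commQQ Srep).
- exact: (rep_commPP Srep).
- exact: (rep_commQP Srep).
- by apply: (rep_disjoint Srep); apply: perp_iso.
- by apply: (rep_QP Srep); apply/Fc.
Qed.

End CatIso.

(** Composition with [F] and [F'] matches the representations of the two categories, and the
    generating set is unchanged. *)
Lemma is_cstar_of_iso (R : realType) (L M : smallCat) (F : L -> M)
    (F' : M -> L) (A : cstarAlg R) (S : M -> A) :
  cat_iso F F' -> is_cstar_of S -> is_cstar_of (S \o F).
Proof.
move=> Fiso SP; have [FK F'K _ _] := Fiso; split.
- exact: (representation_iso Fiso (cstar_of_rep SP)).
- move=> D Dsub Dcl DS; apply: (cstar_of_gen SP) => // _ [f _ <-].
  by apply: DS; exists (F' f) => //=; rewrite F'K.
- move=> B T Bu Trep.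
  have [p [[ph pS] p_uniq]] := cstar_of_univ SP Bu
    (representation_iso (cat_iso_sym Fiso) Trep).
  exists p; split; first by split=> // f; rewrite /= pS /= FK.
  move=> q [qh qS]; apply: p_uniq; split=> // f.
  by have := qS (F' f); rewrite /= F'K.
Qed.

(** * The restricted action and its semi-direct product *)

Section Restriction.
Variables (G : groupoid) (H : smallCat) (alpha : catAction G H).

(** Every object of [H] thus survives in the subcategory, which keeps the restricted moment map
    surjective. *)
Lemma Hr_idm u : Hr alpha (idm u).
Proof. by rewrite /Hr /= src_idm tgt_idm. Qed.

Lemma Hr_subcategory : is_subcategory (Hr alpha).
Proof.
split=> [h _|h _|h k e hr kr]; [exact: Hr_idm | exact: Hr_idm |].
by rewrite /Hr /= src_comp tgt_comp -hr e -kr.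
Qed.

Local Notation K := (subcat Hr_subcategory).

Definition Hr_phi (u : obj K) : obj G := phi alpha (sval u).

Lemma Hr_phi_surj a : exists u, Hr_phi u = a.
Proof. by have [u <-] := phi_surj alpha a; exists (exist _ u (Hr_idm u)). Qed.

(** Both ends of a translate by g are translates of objects by g, and the moment map sends these to
    the target of g. *)
Lemma Hr_act_closed g h (p : fibred (phi alpha) g h) :
  Hr alpha (act alpha g h p).
Proof.
have [e e'] := p; have es : src g = phi alpha (src h) by rewrite e.
by rewrite /Hr /= (src_actE p es) (tgt_actE p e) !phi_actobj.
Qed.

(** The two domain conditions are convertible, so [p] serves for [alpha] as it stands. *)
Definition Hr_act (g : G) (h : K) (p : fibred Hr_phi g h) : K :=
  exist _ (act alpha g (sval h) p) (Hr_act_closed p).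

Lemma Hr_act_src (g : G) (h : K) (p : fibred Hr_phi g h)
  (q : fibred Hr_phi g (idm (src h))) : Hr_act q = idm (src (Hr_act p)).
Proof. by apply: sig_inj; apply: act_src. Qed.

Lemma Hr_act_tgt (g : G) (h : K) (p : fibred Hr_phi g h)
  (q : fibred Hr_phi g (idm (tgt h))) : Hr_act q = idm (tgt (Hr_act p)).
Proof. by apply: sig_inj; apply: act_tgt. Qed.

Lemma Hr_phi_act (g : G) (u v : obj K) (p : fibred Hr_phi g (idm u)) :
  Hr_act p = idm v -> Hr_phi v = tgt g.
Proof. by move=> /(congr1 sval); apply: phi_act. Qed.

Lemma Hr_act_id (h : K) (p : fibred Hr_phi (idm (Hr_phi (tgt h))) h) :
  Hr_act p = h.
Proof. by apply: sig_inj; apply: act_id. Qed.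

Lemma Hr_act_act (g' g : G) (h : K) (e : src g' = tgt g)
    (p : fibred Hr_phi g h) (q : fibred Hr_phi g' (Hr_act p))
    (r : fibred Hr_phi (comp g' g e) h) : Hr_act q = Hr_act r.
Proof. by apply: sig_inj; apply: act_act. Qed.

Lemma Hr_act_comp (g : G) (h' h : K) (e : src h' = tgt h)
    (p' : fibred Hr_phi g h') (p : fibred Hr_phi g h)
    (r : fibred Hr_phi g (comp h' h e))
    (e' : src (Hr_act p') = tgt (Hr_act p)) :
  Hr_act r = comp (Hr_act p') (Hr_act p) e'.
Proof. by apply: sig_inj; apply: act_comp. Qed.

Definition Hr_action : catAction G K :=
  CatAction Hr_phi_surj Hr_act_src Hr_act_tgt Hr_phi_act Hr_act_id
    Hr_act_act Hr_act_comp.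

Lemma Hr_actionP : is_restriction alpha Hr_action.
Proof. by split=> // g h p q; apply: act_congr. Qed.

Definition Hr_incl (x : semidirect Hr_action) : semidirect alpha :=
  exist _ (sval (sval x).1, (sval x).2) (svalP x).

(** The second half of the condition on a morphism (h, g) is, up to conversion, membership of h in
    [Hr]. *)
Definition Hr_corestr (x : semidirect alpha) : semidirect Hr_action :=
  exist _ (exist (Hr alpha) (sval x).1 (proj2 (svalP x)) : mor K, (sval x).2)
    (svalP x).

(** Sources involve the action of the inverse of g, so they are compared through the two actions;
    targets agree by computation. *)
Lemma Hr_incl_src x : src (Hr_incl x) = sval (src x).
Proof. by apply: (congr1 (@src H)); apply: act_congr. Qed.

Lemma Hr_incl_iso : cat_iso Hr_incl Hr_corestr.
Proof.
split=> [x|x|x y|x y e e'].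
- by apply: sd_inj => //; apply: sig_inj.
- exact: sd_inj.
- by rewrite Hr_incl_src; split=> [-> //|xy]; apply: sig_inj.
- by apply: sd_inj; apply: comp_congr => //; apply: act_congr.
Qed.

End Restriction.

Theorem lemma2p9 (R : realType) (G : groupoid) (H : smallCat)
    (alpha : catAction G H) :
  exists (subHr : is_subcategory (Hr alpha))
         (beta : catAction G (subcat subHr)),
    is_restriction alpha beta /\
    forall (A : cstarAlg R) (S : semidirect alpha -> A)
           (B : cstarAlg R) (T : semidirect beta -> B),
      is_cstar_of S -> is_cstar_of T -> star_isomorphic A B.
Proof.
exists (Hr_subcategory alpha), (Hr_action alpha).
split=> [|A S B T SP TP]; first exact: Hr_actionP.
(* Through the isomorphism, [A] is also a C*-algebra of the restricted product, and uniqueness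
   applies. *)
exact: cstar_of_unique (is_cstar_of_iso (Hr_incl_iso alpha) SP) TP.
Qed.
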